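(* Let $a,b,c,d,e$ be real numbers with $|a|+|b|+|c|>0$ and $n\,a+d\neq0$ for all $n\geqslant0$. Let $\{\mu_n\}_{n\geqslant0}$ be a sequence of real numbers such that $\det G_n\neq0$ for all $n\geqslant0$, where $G_n=[\mu_{i+j}]_{i,j=0}^n$. For $n\geqslant0$, let $S_n^{-1}\,H_n\,S_n^{-\top}$ be the Cholesky factorization of $G_n$ and let $\bar s_{n,0},\bar s_{n,1},\dots,\bar s_{n,n}$ denote the columns of $S_n^{\top}$. Then $\{\mu_n\}_{n\geqslant0}$ is a classical sequence satisfying $$(n\,a+d)\,\mu_{n+1}+(n\,b+e)\,\mu_n+n\,c\,\mu_{n-1}=0,\quad n\geqslant0,$$ if and only if $$\mathtt{D}_n\,\bar s_{n,j}=\lambda_j\,\bar s_{n,j},\quad n\geqslant0,\quad 0\leqslant j\leqslant n,$$ where $\lambda_j=j\,[(j-1)\,a+d]$.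
   Context: A sequence of real numbers $\{\mu_n\}_{n\geqslant 0}$ with $\mu_0\neq0$ is pre-classical if there are real numbers $a,b,c,d,e$ with $|a|+|b|+|c|>0$ and $n\,a+d\neq0$ for all $n\geqslant0$, such that $(n\,a+d)\,\mu_{n+1}+(n\,b+e)\,\mu_n+n\,c\,\mu_{n-1}=0$ for all $n\geqslant0$ (with $\mu_n=0$ for $n<0$). It is classical if moreover $\det G_n\neq0$ for all $n\geqslant0$. The Cholesky factorization $G_n=S_n^{-1}H_nS_n^{-\top}$ is the unique one with $S_n$ (equivalently $S_n^{-1}$) unit lower triangular and $H_n$ nonsingular diagonal; $S_n^{-\top}=(S_n^{-1})^{\top}$. The matrix $\mathtt{D}_n$ associated with $a,b,c,d,e$ is the $(n+1)\times(n+1)$ matrix $\mathtt{D}_0=0$, $\mathtt{D}_n=R_n^{\top}N_n$ for $n\geqslant1$, where (rows and columns indexed from $0$) $R_n$ is the $n\times(n+1)$ matrix whose row $k$ ($0\leqslant k\leqslant n-1$) has entries $k\,c$ in column $k-1$ (if $k\geqslant1$), $k\,b+e$ in column $k$, $k\,a+d$ in column $k+1$, and zeros elsewhere; and $N_n$ is the $n\times(n+1)$ matrix with $(N_n)_{k,k+1}=k+1$ for $0\leqslant k\leqslant n-1$ and zeros elsewhere. Equivalently, column $j$ of $\mathtt{D}_n$ has entries $j(j-1)c$ in row $j-2$ (if $j\geqslant2$), $j((j-1)b+e)$ in row $j-1$ (if $j\geqslant1$), $j((j-1)a+d)$ in row $j$, and zeros elsewhere. *)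

(* Defs.v *)
From mathcomp Require Import all_boot all_order all_algebra.
From mathcomp Require Import reals.

Set Implicit Arguments.
Unset Strict Implicit.
Unset Printing Implicit Defensive.

Import Order.TTheory GRing.Theory Num.Theory.
Local Open Scope ring_scope.

Definition hankel (R : realType) (mu : nat -> R) (n : nat) : 'M[R]_n.+1 :=
  \matrix_(i, j) mu (i + j)%N.

(* The term of index n - 1, with the convention that mu vanishes at negative
   indices (truncated subtraction would wrongly give mu 0 when n = 0). *)
Definition prev_term (R : realType) (mu : nat -> R) (n : nat) : R :=
  if n is m.+1 then mu m else 0.

Definition admissible (R : realType) (a b c d : R) : Prop :=
  0 < `|a| + `|b| + `|c| /\ forall n : nat, n%:R * a + d != 0.

Definition moment_recurrence (R : realType) (a b c d e : R) (mu : nat -> R) :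
    Prop :=
  forall n : nat,
    (n%:R * a + d) * mu n.+1 + (n%:R * b + e) * mu n
      + n%:R * c * prev_term mu n = 0.

Definition pre_classical (R : realType) (mu : nat -> R) : Prop :=
  mu 0%N != 0 /\
  exists a b c d e : R, admissible a b c d /\ moment_recurrence a b c d e mu.

Definition classical (R : realType) (mu : nat -> R) : Prop :=
  pre_classical mu /\ forall n : nat, \det (hankel mu n) != 0.

Definition unit_lower (R : realType) (n : nat) (L : 'M[R]_n) : Prop :=
  is_trig_mx L /\ forall i, L i i = 1.

(* H is only nonsingular, not positive: G need not be positive definite. *)
Definition cholesky (R : realType) (n : nat) (G S H : 'M[R]_n) : Prop :=
  [/\ unit_lower S, is_diag_mx H, H \in unitmx
    & G = invmx S *m H *m (invmx S)^T].

Definition Rmx (R : realType) (a b c d e : R) (n : nat) : 'M[R]_(n, n.+1) :=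
  \matrix_(k, j)
    if j.+1 == k :> nat then k%:R * c
    else if j == k :> nat then k%:R * b + e
    else if j == k.+1 :> nat then k%:R * a + d
    else 0.

Definition Nmx (R : realType) (n : nat) : 'M[R]_(n, n.+1) :=
  \matrix_(k, j) if j == k.+1 :> nat then k.+1%:R else 0.

(* For n = 0 the factors have no rows, so this is the zero matrix (Dmx0). *)
Definition Dmx (R : realType) (a b c d e : R) (n : nat) : 'M[R]_n.+1 :=
  (Rmx a b c d e n)^T *m Nmx R n.

Lemma Dmx0 (R : realType) (a b c d e : R) : Dmx a b c d e 0 = 0.
Proof. by apply/matrixP=> i j; rewrite !mxE big_ord0. Qed.

Definition lambda (R : realType) (a d : R) (j : nat) : R :=
  j%:R * ((j%:R - 1) * a + d).

(* Main.v *)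
Require Import Defs.
From mathcomp Require Import all_boot all_order all_algebra.
From mathcomp Require Import reals.
From mathcomp Require Import ring.

Set Implicit Arguments.
Unset Strict Implicit.
Unset Printing Implicit Defensive.

Import Order.TTheory GRing.Theory Num.Theory.
Local Open Scope ring_scope.

(** Put [phi = a x^2 + b x + c], [psi = d x + e], and let [L] be the linear
functional on polynomials with moments [mu n].  Identifying a polynomial with
its column of coefficients, the matrix [Dmx a b c d e n] is the operator
[p |-> phi p'' + psi p'], the Hankel matrix [G] is the Gram matrix of the form
[(p, q) |-> L (p q)], and the columns of [S^T] are the monic orthogonal
polynomials.  The recurrence says that [L (phi q' + psi q) = 0] for all [q].

Both sides of the equivalence express that the operator is symmetric for the
form, i.e. that the matrix [G D] is symmetric for every size.

- Under the recurrence, [L ((phi p'' + psi p') q) = - L (phi p' q')], which is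
  symmetric in [p] and [q].  Conversely, the operator kills the constant
  polynomial [1], so symmetry gives [L (phi p'' + psi p') = 0] for all [p], and
  [p = x^(m+1)] yields [m + 1] times the recurrence of index [m]
  ([symmetric_hankel_DmxP]).

- The operator does not raise degrees, so [D] is upper triangular and
  [W = S D^T S^-1] is lower triangular, with the diagonal of [D].  Congruence
  by [S] turns [G D] into [H W^T], and [H W^T] is symmetric exactly when [W] is
  diagonal, i.e. when the columns of [S^T] are eigenvectors of [D] for its
  diagonal entries [lambda_j] ([symmetric_choleskyP]). *)

Lemma trig_mulmx (R : comNzRingType) n (A B : 'M[R]_n) :
  is_trig_mx A -> is_trig_mx B -> is_trig_mx (A *m B).
Proof.
move=> /is_trig_mxP tA /is_trig_mxP tB; apply/is_trig_mxP => i j ltij.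
rewrite mxE big1 // => k _; case: (ltnP i k) => [ltik|leki].
  by rewrite tA ?mul0r.
by rewrite tB ?mulr0 // (leq_ltn_trans leki).
Qed.

Lemma trig_mulmx_diag (R : comNzRingType) n (A B : 'M[R]_n) i :
  is_trig_mx A -> is_trig_mx B -> (A *m B) i i = A i i * B i i.
Proof.
move=> /is_trig_mxP tA /is_trig_mxP tB.
rewrite mxE (bigD1 i) //= big1 ?addr0 // => k neki.
have [ltik|ltki|eqik] := ltngtP i k.
- by rewrite tA ?mul0r.
- by rewrite tB ?mulr0.
- by case/eqP: neki; apply: val_inj.
Qed.

Lemma trig_divmx_unit_lower (R : realType) n (W S : 'M[R]_n) :
  unit_lower S -> is_trig_mx (W *m S) -> is_trig_mx W.
Proof.
move=> [/is_trig_mxP tS S1] /is_trig_mxP tWS; apply/is_trig_mxP => i j.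
(* Column [j] of [W *m S] involves only the columns of [W] of index at least
   [j]: descending induction on [j]. *)
have [m] := ubnP (n - j); elim: m j => // m IHm j ltm ltij.
have := tWS i j ltij; rewrite mxE (bigD1 j) //= S1 mulr1 big1 ?addr0 // => k.
move=> nekj; have [ltkj|ltjk|eqkj] := ltngtP k j.
- by rewrite tS ?mulr0.
- rewrite IHm ?mul0r ?(ltn_trans ltij) //.
  by rewrite -ltnS (leq_trans _ ltm) // ltnS ltn_sub2l.
- by case/eqP: nekj; apply: val_inj.
Qed.

Lemma unit_lower_unitmx (R : realType) n (S : 'M[R]_n) :
  unit_lower S -> S \in unitmx.
Proof.
by move=> [tS S1]; rewrite unitmxE det_trig // big1 ?unitr1 //.
Qed.

(** [G *m D] is symmetric iff the operator [D] is self-adjoint for the bilinear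
form of Gram matrix [G]; the rows of [S] are the orthogonal basis given by the
factorization of [G]. *)
Lemma symmetric_choleskyP (R : realType) n (G S H D : 'M[R]_n) :
  cholesky G S H -> is_trig_mx D^T ->
  (G *m D)^T = G *m D <-> D *m S^T = S^T *m diag_mx (\row_j D j j).
Proof.
move=> [uS /diag_mxP[h ->] Hunit ->] tD.
have Su := unit_lower_unitmx uS.
have STu : S^T \in unitmx by rewrite unitmx_tr.
have h_neq0 i : h 0 i != 0.
  move: Hunit; rewrite unitmxE unitfE det_diag => /prodf_neq0; exact.
split=> [symGD|eigD].
- have [W defW] : {W | W = S *m D^T *m invmx S} by exists (S *m D^T *m invmx S).
  have WS : W *m S = S *m D^T by rewrite defW mulmxKV.
  have tW : is_trig_mx W.
    apply: (trig_divmx_unit_lower uS); rewrite WS.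
    by apply: trig_mulmx => //; case: uS.
  have Wii i : W i i = D i i.
    have := congr1 (fun A : 'M_n => A i i) WS; case: (uS) => tS S1.
    by rewrite !trig_mulmx_diag // S1 mulr1 mul1r mxE.
  have symW : W *m diag_mx h = diag_mx h *m W^T.
    have E : S *m (invmx S *m diag_mx h *m (invmx S)^T *m D) *m S^T
             = diag_mx h *m W^T.
      by rewrite defW !trmx_mul trmxK !mulmxA mulmxV // mul1mx.
    by rewrite -E -symGD -[LHS]trmxK trmx_mul tr_diag_mx -E !trmx_mul !trmxK
       !mulmxA.
  have Wdiag : W = diag_mx (\row_j D j j).
    have W0 (i j : 'I_n) : (i < j)%N -> W j i = 0.
      move=> ltij; have := congr1 (fun A : 'M_n => A i j) symW.
      rewrite mul_mx_diag mul_diag_mx !mxE (is_trig_mxP tW) // mul0r.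
      by move/esym/eqP; rewrite mulf_eq0 (negPf (h_neq0 i)) /= => /eqP.
    apply/matrixP => i j; rewrite [RHS]mxE [in RHS]mxE.
    have [ltij|ltji|/val_inj eqij] := ltngtP i j.
    + by rewrite (is_trig_mxP tW) // -val_eqE /= ltn_eqF.
    + by rewrite W0 // -val_eqE /= gtn_eqF.
    + by rewrite eqij eqxx Wii.
  by rewrite -[LHS]trmxK trmx_mul trmxK -WS Wdiag trmx_mul tr_diag_mx.
- have eigD' : (invmx S)^T *m D = diag_mx (\row_j D j j) *m (invmx S)^T.
    rewrite trmx_inv; apply: (can_inj (mulKmx STu)); rewrite mulKVmx //.
    apply: (can_inj (mulmxK STu)).
    by rewrite eigD mulmxA mulmxKV.
  rewrite -!mulmxA eigD' !trmx_mul !tr_diag_mx trmxK !mulmxA; congr (_ *m _).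
  by rewrite -!mulmxA; congr (_ *m _); apply: diag_mxC.
Qed.

Lemma mulmx_Nmx0 (R : realType) m n (A : 'M[R]_(m, n)) i :
  (A *m Nmx R n) i ord0 = 0.
Proof. by rewrite mxE big1 // => k _; rewrite mxE mulr0. Qed.

Lemma mulmx_NmxS (R : realType) m n (A : 'M[R]_(m, n)) i (k : 'I_n) :
  (A *m Nmx R n) i (lift ord0 k) = k.+1%:R * A i k.
Proof.
rewrite mxE (bigD1 k) //= mxE eqxx big1 ?addr0 1?mulrC // => l nelk.
by rewrite mxE eqSS val_eqE eq_sym (negPf nelk) mulr0.
Qed.

Lemma Dmx_upper_trig (R : realType) (a b c d e : R) n :
  is_trig_mx (Dmx a b c d e n)^T.
Proof.
apply/is_trig_mxP => j i; rewrite mxE.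
case: (unliftP ord0 j) => [k ->|->]; rewrite ?mulmx_Nmx0 ?mulmx_NmxS // => ltki.
have {}ltki : (k.+1 < i)%N by [].
by rewrite 2!mxE !gtn_eqF ?mulr0 // ltnW // ltnW.
Qed.

Lemma Dmx_diag (R : realType) (a b c d e : R) n (j : 'I_n.+1) :
  Dmx a b c d e n j j = lambda a d j.
Proof.
rewrite /lambda; case: (unliftP ord0 j) => [k ->|->].
  rewrite mulmx_NmxS 2!mxE /= /bump /= add1n.
  rewrite (@gtn_eqF k k.+2) ?(@gtn_eqF k k.+1) //.
  by rewrite eqxx -[k.+1]addn1 natrD addrK.
by rewrite mulmx_Nmx0 mul0r.
Qed.

Lemma sum_Rmx (R : realType) (a b c d e : R) n (k : 'I_n) (f : nat -> R) :
  \sum_(l < n.+1) f l * Rmx a b c d e n k l =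
  (k%:R * a + d) * f k.+1 + (k%:R * b + e) * f k + k%:R * c * prev_term f k.
Proof.
have pick m (x : R) : (m < n.+1)%N ->
    \sum_(l < n.+1) (if l == m :> nat then f l * x else 0) = x * f m.
  by move=> ltm; rewrite -big_mkcond (big_pred1 (Ordinal ltm)) 1?mulrC //.
have ltk := ltn_ord k.
have -> : k%:R * c * prev_term f k =
    \sum_(l < n.+1) (if l.+1 == k :> nat then f l * (k%:R * c) else 0).
  case: (k : nat) ltk => [_|k' ltk]; last by rewrite (pick k') // ltnW // ltnW.
  by rewrite !mul0r big1 // => l _; rewrite mulr0; case: ifP.
rewrite -!pick ?ltnS // 1?ltnW // -!big_split /=; apply: eq_bigr => l _.
rewrite mxE; have [<-|_] := eqVneq l.+1 k.
  by rewrite !ltn_eqF // !add0r.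
have [->|_] := eqVneq (l : nat) k; first by rewrite ltn_eqF // add0r addr0.
by case: ifP => _; rewrite ?mulr0 !addr0.
Qed.

(** Entry [(i, k + 1)] of [G D], that is [L (x^i (phi p'' + psi p'))] for
[p = x^(k+1)].  For [k = 0] the operator gives no term of degree [k - 1], and
the factor [k%:R] cancels the last summand. *)
Lemma hankel_DmxS (R : realType) (a b c d e : R) (mu : nat -> R) n
    (i : 'I_n.+1) (k : 'I_n) :
  (hankel mu n *m Dmx a b c d e n) i (lift ord0 k) =
  k.+1%:R * ((k%:R * a + d) * mu (i + k).+1 + (k%:R * b + e) * mu (i + k)%N
             + k%:R * c * prev_term mu (i + k)).
Proof.
rewrite /Dmx mulmxA mulmx_NmxS; congr (_ * _).
rewrite mxE; under eq_bigr do rewrite 2!mxE.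
rewrite (sum_Rmx _ _ _ _ _ _ (fun l => mu (i + l)%N)) addnS; congr (_ + _).
by case: (k : nat) => [|k']; rewrite ?mul0r // addnS.
Qed.

Lemma hankel_Dmx0 (R : realType) (a b c d e : R) (mu : nat -> R) n
    (i : 'I_n.+1) :
  (hankel mu n *m Dmx a b c d e n) i ord0 = 0.
Proof. by rewrite /Dmx mulmxA mulmx_Nmx0. Qed.

Lemma symmetric_hankel_DmxP (R : realType) (a b c d e : R) (mu : nat -> R) :
  (forall n, (hankel mu n *m Dmx a b c d e n)^T
             = hankel mu n *m Dmx a b c d e n) <->
  moment_recurrence a b c d e mu.
Proof.
split=> [sym m|rec n].
  (* Entries [(0, m + 1)] and [(m + 1, 0)], in the smallest size that has
     them. *)
  have := congr1 (fun A : 'M_m.+2 => A ord0 (lift ord0 ord_max)) (sym m.+1).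
  rewrite mxE hankel_Dmx0 hankel_DmxS /= !add0n => /esym/eqP.
  by rewrite mulf_eq0 pnatr_eq0 /= => /eqP.
apply/matrixP => i j; rewrite mxE.
have row0 (l : 'I_n.+1) : (hankel mu n *m Dmx a b c d e n) ord0 l = 0.
  case: (unliftP ord0 l) => [k ->|->]; rewrite ?hankel_Dmx0 // hankel_DmxS.
  by rewrite !add0n rec mulr0.
case: (unliftP ord0 i) => [i' ->|->]; last by rewrite hankel_Dmx0 row0.
case: (unliftP ord0 j) => [j' ->|->]; last by rewrite hankel_Dmx0 row0.
(* With [p = x^(v+1)] and [q = x^(u+1)], this is
   [L ((phi p'' + psi p') q) = - L (phi p' q')]. *)
have E (u v : 'I_n) :
    (hankel mu n *m Dmx a b c d e n) (lift ord0 u) (lift ord0 v) =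
    - (u.+1%:R * v.+1%:R * (a * mu (u + v).+2 + b * mu (u + v).+1
                            + c * mu (u + v)%N)).
  rewrite hankel_DmxS /= /bump /= add1n addSn /=.
  have := rec (u + v).+1; rewrite /= -addSn natrD => recuv.
  apply/eqP; rewrite -subr_eq0; apply/eqP.
  by rewrite -[RHS](mulr0 v.+1%:R) -recuv addSn; ring.
by rewrite !E (addnC j') (mulrC i'.+1%:R).
Qed.

Theorem theorem5p3 (R : realType) (a b c d e : R)
    (habc : 0 < `|a| + `|b| + `|c|)
    (had : forall n : nat, n%:R * a + d != 0)
    (mu : nat -> R)
    (hdet : forall n : nat, \det (hankel mu n) != 0)
    (Sm Hm : forall n : nat, 'M[R]_n.+1)
    (hchol : forall n : nat, cholesky (hankel mu n) (Sm n) (Hm n)) :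
  (classical mu /\ moment_recurrence a b c d e mu) <->
  (forall (n : nat) (j : 'I_n.+1),
     Dmx a b c d e n *m col j (Sm n)^T = lambda a d j *: col j (Sm n)^T).
Proof.
have eigP n := symmetric_choleskyP (hchol n) (Dmx_upper_trig a b c d e n).
have col_eig n (j : 'I_n.+1) :
    col j ((Sm n)^T *m diag_mx (\row_l Dmx a b c d e n l l)) =
    lambda a d j *: col j (Sm n)^T.
  apply/colP => i; rewrite [LHS]mxE mul_mx_diag 2!mxE -(Dmx_diag a b c d e).
  by rewrite !mxE mulrC.
split=> [[_ /symmetric_hankel_DmxP sym] n j|eig].
  by rewrite -col_eig -((eigP n).1 (sym n)) !colE mulmxA.
have rec : moment_recurrence a b c d e mu.
  apply/symmetric_hankel_DmxP => n; apply/(eigP n); apply/matrixP => i j.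
  have := congr1 (fun v : 'cV_n.+1 => v i 0) (eig n j).
  by rewrite -col_eig [col j (Sm n)^T]colE mulmxA -colE mxE [in RHS]mxE.
split=> //; split=> //; split; last by exists a, b, c, d, e.
by have := hdet 0%N; rewrite det_mx11 mxE.
Qed.
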